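(* Let $q\in(0,1)$, and let $w_n=w_n(q)=\prod_{l=1}^n(1-q^l)$ for $n=0,1,2,\dots$, with $w_0=1$. (i) Define $d_n=P_n^q(S_n(312))$ for all $n\ge 0$, or $d_n=P_n^q(S_n(231))$ for all $n\ge0$. Then (in either case) $$d_n=(1-q)\sum_{k=1}^nq^{k-1}\,\frac{w_{k-1}w_{n-k}}{w_n}\,d_{k-1}d_{n-k},\quad n=1,2,\dots.$$ (ii) Define $d_n=P_n^q(S_n(213))$ for all $n\ge0$, or $d_n=P_n^q(S_n(132))$ for all $n\ge0$. Then (in either case) $$d_n=(1-q)\sum_{k=1}^nq^{(n-k+1)(k-1)}\,\frac{w_{k-1}w_{n-k}}{w_n}\,d_{k-1}d_{n-k},\quad n=1,2,\dots.$$
   Context: $S_n$ is the set of permutations $\sigma=\sigma_1\cdots\sigma_n$ of $[n]=\{1,\dots,n\}$, where $\sigma_i=\sigma(i)$. For $\tau\in S_m$ with $2\le m\le n$, $\sigma\in S_n$ contains $\tau$ as a pattern if there are indices $1\le i_1<\cdots<i_m\le n$ such that for all $1\le j,k\le m$, $\sigma_{i_j}<\sigma_{i_k}$ if and only if $\tau_j<\tau_k$; otherwise $\sigma$ avoids $\tau$. $S_n(\tau)$ is the set of $\sigma\in S_n$ avoiding $\tau$, and $S_n(\tau)=S_n$ if $m>n$. For $q>0$, the Mallows distribution with parameter $q$ is the probability measure on $S_n$ given by $P_n^q(\sigma)=q^{\mathrm{inv}(\sigma)}/Z_n(q)$, where $\mathrm{inv}(\sigma)$ is the number of inversions of $\sigma$,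 i.e. pairs $i<j$ with $\sigma_i>\sigma_j$, and $Z_n(q)=\sum_{\sigma\in S_n}q^{\mathrm{inv}(\sigma)}$, which for $q\neq 1$ equals $\prod_{k=1}^n\frac{1-q^k}{1-q}$. Convention: for $n=0$ the set $S_0$ consists of the empty permutation only, so $P_0^q(S_0(\tau))=1$, i.e. $d_0=1$; likewise $d_1=d_2=1$. *)

(* Defs.v *)
From HB Require Import structures.
From mathcomp Require Import all_boot all_order all_algebra all_fingroup.

Set Implicit Arguments.
Unset Strict Implicit.
Unset Printing Implicit Defensive.

Import Order.TTheory GRing.Theory Num.Theory.

(* Permutations of [n] = {1, ..., n} are elements of 'S_n, i.e. permutations of
   {0, ..., n-1}: positions and values are both shifted down by one, which
   affects neither inversions nor pattern containment. 'S_0 has exactly one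
   element, the empty permutation. *)

Definition inversions (n : nat) (s : 'S_n) : nat :=
  #|[set p : 'I_n * 'I_n | (p.1 < p.2)%N && (s p.2 < s p.1)%N]|.

Definition contains_pattern (m n : nat) (t : 'S_m) (s : 'S_n) : bool :=
  [exists i : {ffun 'I_m -> 'I_n},
    [forall j : 'I_m, forall k : 'I_m, (j < k)%N ==> (i j < i k)%N]
    && [forall j : 'I_m, forall k : 'I_m, (s (i j) < s (i k))%N == (t j < t k)%N]].

Definition avoiders (m : nat) (t : 'S_m) (n : nat) : {set 'S_n} :=
  [set s : 'S_n | ~~ contains_pattern t s].

(* One-line notation: a word w = w_1 ... w_m that rearranges 1, ..., m denotes
   the permutation sending the (0-based) position i to the value w_{i+1} - 1. *)

Lemma oneline_ltn (w : seq nat) (hw : perm_eq w (iota 1 (size w)))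
  (i : 'I_(size w)) : ((nth 0 w i).-1 < size w)%N.
Proof.
have : nth 0 w i \in w by rewrite mem_nth.
by rewrite (perm_mem hw) mem_iota; case: (nth 0 w i).
Qed.

Lemma oneline_inj (w : seq nat) (hw : perm_eq w (iota 1 (size w))) :
  injective (fun i => Ordinal (oneline_ltn hw i)).
Proof.
move=> i j [] e; apply/val_inj/eqP.
have uw : uniq w by rewrite (perm_uniq hw) iota_uniq.
have pos k : (k < size w)%N -> (0 < nth 0 w k)%N.
  by move=> hk; have := mem_nth 0 hk; rewrite (perm_mem hw) mem_iota => /andP[].
have /eqP : nth 0 w i = nth 0 w j.
  by rewrite -[LHS]prednK ?pos // -[RHS]prednK ?pos // e.
by rewrite nth_uniq.
Qed.

Definition oneline (w : seq nat) (hw : perm_eq w (iota 1 (size w))) :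
  'S_(size w) := perm (@oneline_inj w hw).

Lemma onelineE (w : seq nat) (hw : perm_eq w (iota 1 (size w)))
  (i : 'I_(size w)) : oneline hw i = (nth 0 w i).-1 :> nat.
Proof. by rewrite permE. Qed.

Definition pat312 : 'S_3 := @oneline [:: 3; 1; 2]%N isT.
Definition pat231 : 'S_3 := @oneline [:: 2; 3; 1]%N isT.
Definition pat213 : 'S_3 := @oneline [:: 2; 1; 3]%N isT.
Definition pat132 : 'S_3 := @oneline [:: 1; 3; 2]%N isT.

Local Open Scope ring_scope.

Definition mallows_Z (R : realFieldType) (q : R) (n : nat) : R :=
  \sum_(s : 'S_n) q ^+ inversions s.

Definition mallows_pmf (R : realFieldType) (q : R) (n : nat) (s : 'S_n) : R :=
  q ^+ inversions s / mallows_Z q n.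

Definition mallows_prob (R : realFieldType) (q : R) (n : nat)
  (A : {set 'S_n}) : R := \sum_(s in A) mallows_pmf q s.

Definition w_ (R : realFieldType) (q : R) (n : nat) : R :=
  \prod_(1 <= l < n.+1) (1 - q ^+ l).

(* Consistency with the conventions S_n(t) = S_n for m > n, and P_n^q a
   probability measure on S_n for q > 0; in particular d_0 = d_1 = d_2 = 1 for
   patterns of length 3. *)

Lemma avoiders_small (m n : nat) (t : 'S_m) :
  (n < m)%N -> avoiders t n = [set: 'S_n].
Proof.
move=> ltnm; apply/setP=> s; rewrite !inE; apply/negP.
case/existsP=> i /andP[/forallP hi _].
have inj_i : injective i.
  move=> j k e; apply: val_inj; case: (ltngtP j k) => // h.
    by have/forallP/(_ k)/implyP/(_ h) := hi j; rewrite e ltnn.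
  by have/forallP/(_ j)/implyP/(_ h) := hi k; rewrite e ltnn.
by have := leq_card i inj_i; rewrite !card_ord leqNgt ltnm.
Qed.

Lemma mallows_Z_gt0 (R : realFieldType) (q : R) (n : nat) :
  0 < q -> 0 < mallows_Z q n.
Proof.
move=> q0; rewrite /mallows_Z (bigD1 1%g) //= ltr_pwDl ?exprn_gt0 //.
by apply: sumr_ge0 => s _; rewrite exprn_ge0 // ltW.
Qed.

Lemma mallows_pmf_gt0 (R : realFieldType) (q : R) (n : nat) (s : 'S_n) :
  0 < q -> 0 < mallows_pmf q s.
Proof. by move=> q0; rewrite divr_gt0 ?exprn_gt0 ?mallows_Z_gt0. Qed.

Lemma mallows_probT (R : realFieldType) (q : R) (n : nat) :
  0 < q -> mallows_prob q [set: 'S_n] = 1.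
Proof.
move=> q0; rewrite /mallows_prob (eq_bigl xpredT); last by move=> s; rewrite inE.
by rewrite -mulr_suml divff // gt_eqF // mallows_Z_gt0.
Qed.

Lemma mallows_prob_avoiders_small (R : realFieldType) (q : R) (m n : nat)
  (t : 'S_m) : 0 < q -> (n < m)%N -> mallows_prob q (avoiders t n) = 1.
Proof. by move=> q0 ltnm; rewrite avoiders_small // mallows_probT. Qed.

(* Main.v *)
(* Removing the value 1 from position k of a permutation removes k - 1
   inversions; the permutation avoids 312 exactly when what remains is a direct
   sum of two 312-avoiders of sizes k - 1 and n - k. This gives a recurrence for
   the inversion generating function of the 312-avoiders, valid for every
   parameter x; without the avoidance condition, the same removal gives
   Z_n = w_n / (1 - q)^n. Inversion of permutations exchanges 312 and 231.
   Complementing values turns 312 into 132 and 231 into 213 and turns inv into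
   n(n-1)/2 - inv, so (ii) is the recurrence at x = 1/q, with k replaced by
   n - k + 1. *)
Require Import Defs.
From HB Require Import structures.
From mathcomp Require Import all_boot all_order all_algebra all_fingroup.
From mathcomp Require Import zify ring.

Set Implicit Arguments.
Unset Strict Implicit.
Unset Printing Implicit Defensive.

Import Order.TTheory GRing.Theory Num.Theory.
Local Open Scope ring_scope.

(** * Occurrences of patterns of length three as inequalities *)

Lemma ltn_perm_sym (n : nat) (s : 'S_n) (i j : 'I_n) :
  i != j -> (s j < s i)%N = ~~ (s i < s j)%N.
Proof.
move=> nij; rewrite -leqNgt [RHS]leq_eqVlt; case: eqP => // /ord_inj/perm_inj e.
by rewrite e eqxx in nij.
Qed.

(** An increasing map from three positions is a triple [i < j < k], and three comparisons of values
    suffice because the reversed ones follow by injectivity. *)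
Lemma contains3P (n : nat) (t : 'S_3) (s : 'S_n) :
  reflect (exists i j k : 'I_n, [/\ (i < j)%N, (j < k)%N,
             (s i < s j)%N = (t ord0 < t 1%R)%N,
             (s i < s k)%N = (t ord0 < t ord_max)%N &
             (s j < s k)%N = (t 1%R < t ord_max)%N])
          (contains_pattern t s).
Proof.
apply: (iffP existsP) => [[f /andP[/forallP mono /forallP pat]]|].
  have mono' (a b : 'I_3) : (a < b)%N -> (f a < f b)%N.
    by have /forallP/(_ b)/implyP := mono a.
  have pat' (a b : 'I_3) : (s (f a) < s (f b))%N = (t a < t b)%N.
    by have /forallP/(_ b)/eqP := pat a.
  by exists (f ord0), (f 1), (f ord_max); split; rewrite ?pat' ?mono'.
case=> i [j [k [ij jk sij sik sjk]]].
have ik := ltn_trans ij jk.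
exists [ffun a : 'I_3 => tnth [tuple i; j; k] a]; apply/andP; split.
  apply/forallP=> a; apply/forallP=> b; apply/implyP; rewrite !ffunE.
  by case: a b => [[|[|[|//]]] ha] [[|[|[|//]]] hb].
have e0 h : Ordinal (h : (0 < 3)%N) = ord0 by apply: val_inj.
have e1 h : Ordinal (h : (1 < 3)%N) = 1 by apply: val_inj.
have e2 h : Ordinal (h : (2 < 3)%N) = ord_max by apply: val_inj.
have [nij njk nik] : [/\ i != j, j != k & i != k].
  by rewrite -!val_eqE /= !ltn_eqF.
apply/forallP=> a; apply/forallP=> b; apply/eqP; rewrite !ffunE.
case: a b => [[|[|[|//]]] ha] [[|[|[|//]]] hb];
  rewrite ?e0 ?e1 ?e2 !(tnth_nth i) /= ?ltnn //.
(* What remains are the comparisons with the larger index first; [ltn_perm_sym] is applied to [s],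
   then backwards to [t]. *)
- by rewrite ltn_perm_sym // sij -ltn_perm_sym.
- by rewrite ltn_perm_sym // sik -ltn_perm_sym.
- by rewrite ltn_perm_sym // sjk -ltn_perm_sym.
Qed.

Lemma pat312E (i : 'I_3) : pat312 i = (nth 0%N [:: 3; 1; 2]%N i).-1 :> nat.
Proof. exact: (@onelineE [:: 3; 1; 2]%N isT). Qed.

Lemma pat231E (i : 'I_3) : pat231 i = (nth 0%N [:: 2; 3; 1]%N i).-1 :> nat.
Proof. exact: (@onelineE [:: 2; 3; 1]%N isT). Qed.

Lemma pat213E (i : 'I_3) : pat213 i = (nth 0%N [:: 2; 1; 3]%N i).-1 :> nat.
Proof. exact: (@onelineE [:: 2; 1; 3]%N isT). Qed.

Lemma pat132E (i : 'I_3) : pat132 i = (nth 0%N [:: 1; 3; 2]%N i).-1 :> nat.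
Proof. exact: (@onelineE [:: 1; 3; 2]%N isT). Qed.

Lemma contains312P (n : nat) (s : 'S_n) :
  reflect (exists i j k : 'I_n,
             [/\ (i < j)%N, (j < k)%N, (s j < s k)%N & (s k < s i)%N])
          (contains_pattern pat312 s).
Proof.
apply: (iffP (contains3P _ _)) => -[i [j [k]]]; rewrite !pat312E /=.
  case=> ij jk sij sik sjk; exists i, j, k; split=> //.
  by rewrite ltn_perm_sym ?sik // -val_eqE /= ltn_eqF // (ltn_trans ij).
case=> ij jk sjk ski; exists i, j, k.
by split=> //; apply/negbTE; rewrite -leqNgt ltnW // (ltn_trans sjk).
Qed.

Lemma contains231P (n : nat) (s : 'S_n) :
  reflect (exists i j k : 'I_n,
             [/\ (i < j)%N, (j < k)%N, (s k < s i)%N & (s i < s j)%N])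
          (contains_pattern pat231 s).
Proof.
apply: (iffP (contains3P _ _)) => -[i [j [k]]]; rewrite !pat231E /=.
  case=> ij jk sij sik sjk; exists i, j, k; split=> //.
  by rewrite ltn_perm_sym ?sik // -val_eqE /= ltn_eqF // (ltn_trans ij).
case=> ij jk ski sij; exists i, j, k.
by split=> //; apply/negbTE; rewrite -leqNgt ltnW // (ltn_trans ski).
Qed.

(** * Inversion of permutations *)

Lemma contains231V (n : nat) (s : 'S_n) :
  contains_pattern pat231 s^-1%g = contains_pattern pat312 s.
Proof.
apply/contains231P/contains312P => -[i [j [k [ij jk ski sij]]]].
  (* At these positions [s] takes the values [k], [i], [j], which form a 312; the positions increase
     because the given triple is a 231 of the inverse. *)
  by exists (s^-1 k)%g, (s^-1 i)%g, (s^-1 j)%g; rewrite !permKV.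
by exists (s j), (s k), (s i); rewrite !permK.
Qed.

(** The map from [(i, j)] to [(s j, s i)] carries inversions of [s] bijectively to inversions of its
    inverse. *)
Lemma inversionsV (n : nat) (s : 'S_n) : inversions s^-1%g = inversions s.
Proof.
rewrite /inversions -[RHS](card_imset _ (f := fun p => (s p.2, s p.1))).
  congr #|pred_of_set _|; apply/setP=> -[a b]; rewrite !inE /=.
  apply/idP/imsetP => [/andP[ab sba]|[[i j]]].
    exists (s^-1 b, s^-1 a)%g; last by rewrite /= !permKV.
    by rewrite inE /= !permKV sba.
  by rewrite inE /= => /andP[ij sji] [-> ->]; rewrite !permK ij sji.
by move=> [a b] [c d] [/perm_inj-> /perm_inj->].
Qed.

(** * Counting in ordinals, and inversions as a double sum *)

Lemma sum_ltn_ord (n k : nat) : (k <= n)%N -> (\sum_(i < n) (i < k)%N = k)%N.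
Proof.
move=> kn; rewrite -big_mkcond /= -(big_ord_widen _ (fun=> 1%N) kn).
by rewrite sum1_card card_ord.
Qed.

Lemma sum_gtn_ord (n k : nat) : (\sum_(i < n) (k <= i)%N = n - k)%N.
Proof.
case: (leqP k n) => [kn|nk].
  have : (\sum_(i < n) ((i < k)%N + (k <= i)%N) = n)%N.
    rewrite (eq_bigr (fun=> 1%N)) => [|i _]; first by rewrite sum1_card card_ord.
    by case: ltnP.
  by rewrite big_split /= sum_ltn_ord // => /(canRL (addKn k)).
rewrite big1 => [|i _]; first by lia.
by rewrite leqNgt (ltn_trans (ltn_ord i)).
Qed.

Lemma inversionsE (n : nat) (s : 'S_n) :
  inversions s = (\sum_(i < n) \sum_(j < n) ((i < j) && (s j < s i)))%N.
Proof.
rewrite pair_bigA /inversions -sum1_card big_mkcond /=.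
by apply: eq_bigr => p _; rewrite inE.
Qed.

(** * Complementing values *)

Section Complement.
Variable n : nat.
Implicit Type s : 'S_n.

Definition rev_perm : 'S_n := perm (@rev_ord_inj n).

Lemma ltn_comp_rev s (i j : 'I_n) :
  ((s * rev_perm)%g i < (s * rev_perm)%g j)%N = (s j < s i)%N.
Proof. by rewrite !permM !permE /=; have := ltn_ord (s i); lia. Qed.

Lemma comp_revK : involutive (fun s => s * rev_perm)%g.
Proof.
by move=> s; apply/permP=> i; rewrite !permM !permE rev_ordK.
Qed.

(** The hypothesis makes [t'] the complement of [t]. Complementing both permutation and pattern
    flips every comparison, so the same positions carry an occurrence. *)
Lemma contains_comp_rev (t t' : 'S_3) s :
    (forall i j : 'I_3, (i < j)%N -> (t' i < t' j)%N = ~~ (t i < t j)%N) ->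
  contains_pattern t' (s * rev_perm)%g = contains_pattern t s.
Proof.
move=> tt'.
have rev_lt (i j : 'I_n) : (i < j)%N ->
    ((s * rev_perm)%g i < (s * rev_perm)%g j)%N = ~~ (s i < s j)%N.
  by move=> ij; rewrite ltn_comp_rev ltn_perm_sym // -val_eqE /= ltn_eqF.
apply/contains3P/contains3P => -[i [j [k [ij jk]]]]; have ik := ltn_trans ij jk.
  rewrite !rev_lt // !tt' // => /negb_inj ? /negb_inj ? /negb_inj ?.
  by exists i, j, k.
by move=> sij sik sjk; exists i, j, k; rewrite !rev_lt // !tt' // sij sik sjk.
Qed.

(** Each pair of positions is an inversion of exactly one of [s] and its complement. *)
Lemma inversions_comp_rev s :
  (inversions s + inversions (s * rev_perm)%g)%N = 'C(n, 2).
Proof.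
rewrite !inversionsE -big_split /= -bin2_sum big_mkord.
transitivity (\sum_(i < n) \sum_(j < n) (i < j))%N.
  apply: eq_bigr => i _; rewrite -big_split /=; apply: eq_bigr => j _.
  rewrite ltn_comp_rev; case: ltnP => //= ij.
  by rewrite ltn_perm_sym -?val_eqE /= ?(ltn_eqF ij) //; case: ltnP.
rewrite exchange_big /=; apply: eq_bigr => j _.
by rewrite sum_ltn_ord // ltnW.
Qed.

End Complement.

(** * Inversion generating functions and their symmetries *)

Definition inv_gf (F : fieldType) (x : F) (n : nat) (A : {set 'S_n}) : F :=
  \sum_(s in A) x ^+ inversions s.

Lemma inv_gf231 (F : fieldType) (x : F) (n : nat) :
  inv_gf x (avoiders pat231 n) = inv_gf x (avoiders pat312 n).
Proof.
rewrite /inv_gf (reindex_inj invg_inj) /=.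
by apply: eq_big => s; rewrite ?inE ?contains231V // inversionsV.
Qed.

Lemma inv_gf_compl (F : fieldType) (x : F) (n : nat) (t t' : 'S_3) :
    x != 0 ->
    (forall i j : 'I_3, (i < j)%N -> (t' i < t' j)%N = ~~ (t i < t j)%N) ->
  inv_gf x (avoiders t' n) = x ^+ 'C(n, 2) * inv_gf x^-1 (avoiders t n).
Proof.
move=> x0 tt'; rewrite /inv_gf (reindex_inj (inv_inj (@comp_revK n))) mulr_sumr.
apply: eq_big => s; first by rewrite !inE (contains_comp_rev _ tt').
by move=> _; rewrite -(inversions_comp_rev s) exprD mulrAC exprVn divff ?mul1r
  // expf_neq0.
Qed.

(** * Inserting a new minimum at position [k] *)

Section InsertMin.
Variables (n : nat) (k : 'I_n.+1) (s : 'S_n).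

Lemma ltn_lift m (h : 'I_m.+1) (i j : 'I_m) : (lift h i < lift h j)%N = (i < j)%N.
Proof. by rewrite /= !ltnNge leq_bump2. Qed.

(** The new minimum forms an inversion with each of the [k] entries to its left and with no entry to
    its right. *)
Lemma inversions_insert :
  inversions (lift_perm k ord0 s) = (k + inversions s)%N.
Proof.
rewrite !inversionsE (bigD1_ord k) //= big1 ?add0n; last first.
  by move=> j _; rewrite lift_perm_id andbF.
transitivity (\sum_(i < n) ((i < k)%N + \sum_(j < n) ((i < j) && (s j < s i))))%N.
  apply: eq_bigr => i _; rewrite (bigD1_ord k) //=.
  rewrite lift_perm_id lift_perm_lift /= andbT; congr addn.
    by congr nat_of_bool; rewrite /bump; lia.
  by apply: eq_bigr => j _; rewrite !lift_perm_lift !ltn_lift.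
by rewrite big_split /= sum_ltn_ord // -ltnS.
Qed.

(** In an occurrence of 312 the minimum can only be the middle letter. A new occurrence is thus a
    larger value left of the insertion point and a smaller one right of it. *)
Lemma contains312_insert :
  contains_pattern pat312 (lift_perm k ord0 s) =
  contains_pattern pat312 s
    || [exists i : 'I_n, exists j : 'I_n, (i < k <= j)%N && (s j < s i)%N].
Proof.
apply/contains312P/orP => [[i [j [l [ij jl]]]]|[/contains312P|/existsP]].
- case: (unliftP k i) ij => [i' ->|->]; last by rewrite lift_perm_id.
  case: (unliftP k l) jl => [l' ->|->]; last by rewrite lift_perm_id.
  case: (unliftP k j) => [j' ->|->]; rewrite !lift_perm_lift ?lift_perm_id !ltn_lift.
    by move=> jl ij sjl sli; left; apply/contains312P; exists i', j', l'.
  move=> kl ik _ sli; right; apply/existsP; exists i'; apply/existsP; exists l'.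
  by rewrite sli andbT; move: kl ik; rewrite /= /bump; lia.
- case=> i [j [l [ij jl sjl sli]]].
  by exists (lift k i), (lift k j), (lift k l); rewrite !lift_perm_lift !ltn_lift.
case=> i /existsP[j /andP[/andP[ik kj] sji]].
exists (lift k i), k, (lift k j); rewrite !lift_perm_lift lift_perm_id ltn_lift.
by split=> //=; rewrite /bump; lia.
Qed.

End InsertMin.

Lemma insert_inj (n : nat) :
  injective (fun p : 'I_n.+1 * 'S_n => lift_perm p.1 ord0 p.2).
Proof.
(* The insertion position is recovered as the preimage of the value [ord0]. *)
move=> [k s] [l t] /= e; have kl : k = l.
  by apply: (@perm_inj _ (lift_perm k ord0 s)); rewrite {2}e !lift_perm_id.
rewrite -{l}kl in e *; congr pair; apply/permP=> i.
by apply: (@lift_inj _ ord0); rewrite -!(lift_perm_lift k) e.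
Qed.

(** Insertion is injective, hence bijective because both sides have (n+1)! elements. *)
Lemma big_perm_insert (R : Type) (idx : R) (op : Monoid.com_law idx) (n : nat)
    (P : pred 'S_n.+1) (f : 'S_n.+1 -> R) :
  \big[op/idx]_(s | P s) f s =
  \big[op/idx]_(k < n.+1) \big[op/idx]_(s | P (lift_perm k ord0 s))
     f (lift_perm k ord0 s).
Proof.
rewrite pair_big_dep /= (reindex (fun p : 'I_n.+1 * 'S_n => lift_perm p.1 ord0 p.2)) //.
apply/onW_bij/(inj_card_bij (@insert_inj n)).
by rewrite card_prod !card_Sn card_ord factS.
Qed.

(** * Direct sums of permutations *)

Section DirectSum.
Variables a b : nat.

Definition dsum_fun (s : 'S_a) (t : 'S_b) (i : 'I_(a + b)) : 'I_(a + b) :=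
  match split i with inl j => lshift b (s j) | inr j => rshift a (t j) end.

Lemma dsum_funL s t i : dsum_fun s t (lshift b i) = lshift b (s i).
Proof. by rewrite /dsum_fun (unsplitK (inl _ i)). Qed.

Lemma dsum_funR s t i : dsum_fun s t (rshift a i) = rshift a (t i).
Proof. by rewrite /dsum_fun (unsplitK (inr _ i)). Qed.

Lemma dsum_fun_inj s t : injective (dsum_fun s t).
Proof.
move=> i j; case: (split_ordP i) => i' ->; case: (split_ordP j) => j' ->;
  rewrite ?(dsum_funL, dsum_funR).
- by move=> /lshift_inj/perm_inj->.
- by move/eqP; rewrite eq_lrshift.
- by move/eqP; rewrite eq_rlshift.
- by move=> /rshift_inj/perm_inj->.
Qed.

Definition dsum (s : 'S_a) (t : 'S_b) : 'S_(a + b) := perm (@dsum_fun_inj s t).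

Lemma dsumL s t i : dsum s t (lshift b i) = lshift b (s i).
Proof. by rewrite permE dsum_funL. Qed.

Lemma dsumR s t i : dsum s t (rshift a i) = rshift a (t i).
Proof. by rewrite permE dsum_funR. Qed.

Lemma inversions_dsum s t :
  inversions (dsum s t) = (inversions s + inversions t)%N.
Proof.
rewrite !inversionsE big_split_ord /=; congr addn; apply: eq_bigr => i _.
  rewrite big_split_ord /= [X in (_ + X)%N]big1 ?addn0.
    by apply: eq_bigr => j _; rewrite !dsumL.
  by move=> j _; rewrite dsumL dsumR /=; have := ltn_ord (s i); lia.
rewrite big_split_ord /= big1 ?add0n.
  by apply: eq_bigr => j _; rewrite !dsumR /= !ltn_add2l.
by move=> j _; have := ltn_ord j; lia.
Qed.

(** 312 is not itself a direct sum. An occurrence meeting both blocks would have a right-block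
    position before a left-block one, or its first letter in the left block above a last letter in
    the right block. *)
Lemma contains312_dsum s t :
  contains_pattern pat312 (dsum s t) =
  contains_pattern pat312 s || contains_pattern pat312 t.
Proof.
apply/contains312P/orP => [[i [j [k []]]]|[]/contains312P[i [j [k [ij jk sjk ski]]]]].
- case: (split_ordP i) => i' ->; case: (split_ordP j) => j' ->;
  case: (split_ordP k) => k' ->; rewrite ?(dsumL, dsumR) /=;
  rewrite ?ltn_add2l => ij jk sjk ski;
  try (by left; apply/contains312P; exists i', j', k');
  try (by right; apply/contains312P; exists i', j', k').
  + by have := ltn_ord (s i'); lia.
  + by have := ltn_ord k'; lia.
  + by have := ltn_ord (s i'); lia.
  + by have := ltn_ord j'; lia.
  + by have := ltn_ord j'; lia.
  + by have := ltn_ord k'; lia.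
- by exists (lshift b i), (lshift b j), (lshift b k); rewrite !dsumL.
- by exists (rshift a i), (rshift a j), (rshift a k); rewrite !dsumR /= !ltn_add2l.
Qed.

Lemma dsum_inj : injective (fun p : 'S_a * 'S_b => dsum p.1 p.2).
Proof.
move=> [s t] [s' t'] /= e; congr pair; apply/permP=> i.
  by apply: (@lshift_inj a b); rewrite -!(dsumL _ t) e dsumL dsumL.
by apply: (@rshift_inj a b); rewrite -!(dsumR s) e dsumR dsumR.
Qed.

(** This is the condition that a minimum inserted between the two blocks creates no new 312; it
    characterises direct sums. *)
Definition separated (s : 'S_(a + b)) : bool :=
  [forall i : 'I_a, forall j : 'I_b, s (lshift b i) < s (rshift a j)]%N.

Lemma dsum_separated s t : separated (dsum s t).
Proof.
apply/forallP=> i; apply/forallP=> j; rewrite dsumL dsumR /=.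
by rewrite ltn_addr.
Qed.

Lemma card_ord_lt n (m : 'I_n) : #|[set v : 'I_n | v < m]%N| = m.
Proof.
rewrite -sum1_card big_mkcond /= -[RHS](@sum_ltn_ord n) ?(ltnW (ltn_ord m)) //.
by apply: eq_bigr => i _; rewrite inE.
Qed.

Lemma card_ord_gt n (m : 'I_n) : #|[set v : 'I_n | m < v]%N| = (n - m.+1)%N.
Proof.
rewrite -sum1_card big_mkcond /= -[RHS]sum_gtn_ord.
by apply: eq_bigr => i _; rewrite inE.
Qed.

(** All [b] values taken on the right block lie above this one, so at least [b] values exceed it. *)
Lemma separatedL s i : separated s -> (s (lshift b i) < a)%N.
Proof.
move=> /forallP/(_ i)/forallP sep.
have : (#|[set s (rshift a j) | j in [set: 'I_b]]| <=
        #|[set v : 'I_(a + b) | s (lshift b i) < v]%N|)%N.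
  by apply/subset_leq_card/subsetP=> _ /imsetP[j _ ->]; rewrite inE.
rewrite card_imset => [|j j' /perm_inj/rshift_inj//].
rewrite cardsT card_ord card_ord_gt.
by have := ltn_ord (s (lshift b i)); lia.
Qed.

Lemma separatedR s j : separated s -> (a <= s (rshift a j))%N.
Proof.
move=> /forallP sep.
have : (#|[set s (lshift b i) | i in [set: 'I_a]]| <=
        #|[set v : 'I_(a + b) | v < s (rshift a j)]%N|)%N.
  apply/subset_leq_card/subsetP=> _ /imsetP[i _ ->]; rewrite inE.
  by have /forallP := sep i.
rewrite card_imset => [|i i' /perm_inj/lshift_inj//].
by rewrite cardsT card_ord card_ord_lt.
Qed.

(** By the two bounds [s] maps each block of positions into the block of values of the same size;
    the restrictions inherit injectivity. *)
Lemma separated_dsum s : separated s -> exists u v, s = dsum u v.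
Proof.
move=> sep.
have hL i : exists j, s (lshift b i) = lshift b j.
  by exists (Ordinal (separatedL i sep)); apply: val_inj.
have hR i : exists j, s (rshift a i) = rshift a j.
  case: (split_ordP (s (rshift a i))) => j e; last by exists j.
  by have := separatedR i sep; rewrite e /= leqNgt ltn_ord.
have {hL} [f hf] := fin_all_exists hL; have {hR} [g hg] := fin_all_exists hR.
have fI : injective f.
  by move=> i j e; apply/(@lshift_inj a b)/(@perm_inj _ s); rewrite !hf e.
have gI : injective g.
  by move=> i j e; apply/(@rshift_inj a b)/(@perm_inj _ s); rewrite !hg e.
exists (perm fI), (perm gI); apply/permP=> i.
by case: (split_ordP i) => j ->; rewrite (dsumL, dsumR) permE.
Qed.

(** [dsum] is a bijection from pairs of avoiders onto separated avoiders, and inversions add up, so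
    the sum factors. *)
Lemma inv_gf312_separated (F : fieldType) (x : F) :
  \sum_(s in avoiders pat312 (a + b) | separated s) x ^+ inversions s =
  inv_gf x (avoiders pat312 a) * inv_gf x (avoiders pat312 b).
Proof.
rewrite /inv_gf big_distrl /=; under [RHS]eq_bigr do rewrite big_distrr /=.
rewrite pair_big /=.
transitivity (\sum_(s in [set dsum p.1 p.2 | p : 'S_a * 'S_b in
    [set p | (p.1 \in avoiders pat312 a) && (p.2 \in avoiders pat312 b)]])
    x ^+ inversions s).
  apply: eq_bigl => s; rewrite inE; apply/andP/imsetP => [[av]|[p]].
    case/separated_dsum=> u [v e]; exists (u, v) => //=.
    by move: av; rewrite e contains312_dsum negb_or !inE.
  by rewrite !inE -negb_or -contains312_dsum => ? ->; rewrite dsum_separated.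
rewrite big_imset /=; last by move=> p p' _ _; apply: dsum_inj.
by apply: eq_big => p; rewrite ?inE // inversions_dsum exprD.
Qed.

End DirectSum.

(** * Recurrences for the generating functions *)

Lemma inv_gf312_split (F : fieldType) (x : F) (n k : nat) : (k <= n)%N ->
  \sum_(s : 'S_n | ~~ (contains_pattern pat312 s
      || [exists i : 'I_n, exists j : 'I_n, (i < k <= j)%N && (s j < s i)%N]))
    x ^+ inversions s =
  inv_gf x (avoiders pat312 k) * inv_gf x (avoiders pat312 (n - k)).
Proof.
(* Writing [n] as [k + b] makes the block structure of direct sums available in the types. *)
move=> kn; have [b nE] : exists b, n = (k + b)%N by exists (n - k)%N; rewrite subnKC.
subst n; rewrite addKn -inv_gf312_separated; apply: eq_bigl => s.
rewrite negb_or inE; congr andb; apply/idP/idP => [sep|/forallP sep].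
  apply/forallP=> i; apply/forallP=> j; rewrite ltnNge; apply: contra sep => le.
  apply/existsP; exists (lshift b i); apply/existsP; exists (rshift k j).
  rewrite /= ltn_ord leq_addr /= ltn_neqAle le andbT; apply/eqP.
  by move=> /ord_inj/perm_inj/eqP; rewrite eq_rlshift.
apply/existsP=> -[i /existsP[j /andP[/andP[ik kj]]]].
case: (split_ordP i) ik => i' -> /=; last by lia.
case: (split_ordP j) kj => j' -> /=; first by have := ltn_ord j'; lia.
by have /forallP/(_ j') := sep i'; lia.
Qed.

(** The avoiders are sorted by the position [k] of their minimum, which contributes the factor
    [x ^+ k]. *)
Lemma inv_gf312S (F : fieldType) (x : F) (n : nat) :
  inv_gf x (avoiders pat312 n.+1) =
  \sum_(k < n.+1) x ^+ k *
     (inv_gf x (avoiders pat312 k) * inv_gf x (avoiders pat312 (n - k))).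
Proof.
rewrite /inv_gf big_perm_insert; apply: eq_bigr => k _.
rewrite -/(inv_gf _ _) -/(inv_gf _ _) -inv_gf312_split; last by rewrite -ltnS.
rewrite mulr_sumr; apply: eq_big => s.
  by rewrite inE contains312_insert.
by rewrite inversions_insert exprD.
Qed.

(** Pairs in a set split into parts of sizes a+1 and b; the pairs inside the first part are counted
    as a + C(a,2). *)
Lemma bin2_addS (a b : nat) :
  'C((a + b).+1, 2) = (a + a.+1 * b + 'C(b, 2) + 'C(a, 2))%N.
Proof.
elim: a => [|a IH]; first by rewrite add0n binS bin1 bin0n /=; lia.
by rewrite addSn binS IH bin1 [in RHS]binS bin1; lia.
Qed.

Lemma inv_gf132 (F : fieldType) (x : F) (n : nat) : x != 0 ->
  inv_gf x (avoiders pat132 n) = x ^+ 'C(n, 2) * inv_gf x^-1 (avoiders pat312 n).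
Proof.
move=> x0; apply: inv_gf_compl => // i j ij; rewrite !pat132E !pat312E.
by case: i j ij => [[|[|[|//]]] ?] [[|[|[|//]]] ?].
Qed.

Lemma inv_gf213 (F : fieldType) (x : F) (n : nat) : x != 0 ->
  inv_gf x (avoiders pat213 n) = inv_gf x (avoiders pat132 n).
Proof.
move=> x0; rewrite inv_gf132 // -inv_gf231.
apply: inv_gf_compl => // i j ij; rewrite !pat213E !pat231E.
by case: i j ij => [[|[|[|//]]] ?] [[|[|[|//]]] ?].
Qed.

Lemma inv_gf132S (F : fieldType) (x : F) (n : nat) : x != 0 ->
  inv_gf x (avoiders pat132 n.+1) =
  \sum_(k < n.+1) x ^+ ((n - k).+1 * k) *
     (inv_gf x (avoiders pat132 k) * inv_gf x (avoiders pat132 (n - k))).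
Proof.
(* The reindexing replaces [k] by [n - k], so the 312 recurrence at the inverse of [x] contributes
   [x^-1 ^+ (n - k)]. *)
move=> x0; rewrite inv_gf132 // inv_gf312S mulr_sumr (reindex_inj rev_ord_inj) /=.
apply: eq_bigr => k _; have kn : (k <= n)%N by rewrite -ltnS.
rewrite subSS subKn // !inv_gf132 //.
(* The summand [n - k] cancels that power, the two binomials turn the 312 factors at the inverse of
   [x] into 132 factors at [x], and the product is the exponent left over. *)
have -> : 'C(n.+1, 2) = ((n - k) + (n - k).+1 * k + 'C(k, 2) + 'C(n - k, 2))%N.
  by rewrite -bin2_addS subnK.
rewrite !exprD exprVn; have : x ^+ (n - k) != 0 by rewrite expf_neq0.
set y := x ^+ (n - k); set g := inv_gf _ _; set h := inv_gf _ _ => y0.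
by field.
Qed.

(** * Normalisation to Mallows probabilities *)

Section Mallows.
Variables (R : realFieldType) (q : R).
Hypotheses (hq0 : 0 < q) (hq1 : q < 1).

Lemma mallows_ZS (n : nat) :
  mallows_Z q n.+1 = (\sum_(k < n.+1) q ^+ k) * mallows_Z q n.
Proof.
rewrite /mallows_Z big_perm_insert /= mulr_suml; apply: eq_bigr => k _.
rewrite mulr_sumr; apply: eq_bigr => s _.
by rewrite inversions_insert exprD.
Qed.

(** Passing from n to n+1 multiplies Z by 1 + q + ... + q^n; times 1 - q this is 1 - q^(n+1), the
    new factor of [w_]. *)
Lemma w_E (n : nat) : w_ q n = (1 - q) ^+ n * mallows_Z q n.
Proof.
elim: n => [|n IH].
  rewrite /w_ /mallows_Z big_nil mul1r (eq_bigr (fun=> 1)) => [|s _].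
    by rewrite sumr_const card_Sn.
  by rewrite inversionsE big_ord0.
rewrite /w_ big_nat_recr //= -/(w_ q n) IH mallows_ZS.
by rewrite -[1 - q ^+ _]opprB subrX1 exprS; ring.
Qed.

Lemma mallows_probE (n : nat) (A : {set 'S_n}) :
  mallows_prob q A = inv_gf q A / mallows_Z q n.
Proof. by rewrite /mallows_prob -mulr_suml. Qed.

(** With the sets and the exponent abstract, one normalisation serves both parts: divide the
    recurrence by Z and express each [w_] through [w_E]. *)
Lemma mallows_prob_rec (A : forall n, {set 'S_n}) (e : nat -> nat -> nat) :
    (forall n, inv_gf q (A n.+1) =
       \sum_(k < n.+1) q ^+ e n.+1 k.+1 * (inv_gf q (A k) * inv_gf q (A (n - k)%N))) ->
  forall n, (1 <= n)%N ->
    mallows_prob q (A n) = (1 - q) * \sum_(1 <= k < n.+1)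
      q ^+ e n k * (w_ q (k - 1) * w_ q (n - k) / w_ q n)
      * mallows_prob q (A (k - 1)%N) * mallows_prob q (A (n - k)%N).
Proof.
(* The sum is shifted to start at 0, so [k] now stands for one less than the index in the
   statement. *)
move=> rec [//|n] _; rewrite mallows_probE rec big_add1 /= big_mkord.
rewrite mulr_suml mulr_sumr; apply: eq_bigr => k _.
rewrite subn1 /= subSS !mallows_probE !w_E.
have Z0 m : mallows_Z q m != 0 by rewrite gt_eqF ?mallows_Z_gt0.
have q1 : 1 - q != 0 by rewrite subr_eq0 gt_eqF.
have kn : (k <= n)%N by rewrite -ltnS.
(* The powers for [k] and [n - k] cancel against those in the numerator; the one factor left over
   accounts for the leading [1 - q]. *)
have -> : (1 - q) ^+ n.+1 = (1 - q) * ((1 - q) ^+ k * (1 - q) ^+ (n - k)).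
  by rewrite -exprD subnKC // exprS.
have p0 m : (1 - q) ^+ m != 0 by rewrite expf_neq0.
move: (Z0 k) (Z0 (n - k)%N) (Z0 n.+1) (p0 k) (p0 (n - k)%N).
set z1 := mallows_Z q k; set z2 := mallows_Z q (n - k); set z3 := mallows_Z q n.+1.
set p1 := _ ^+ k; set p2 := _ ^+ (n - k) => z10 z20 z30 p10 p20.
by field; rewrite z10 z20 z30 p10 p20.
Qed.

End Mallows.

Theorem proposition4 (R : realFieldType) (q : R) (hq0 : 0 < q) (hq1 : q < 1) :
  (forall d : nat -> R,
     (forall n : nat, d n = mallows_prob q (avoiders pat312 n)) \/
     (forall n : nat, d n = mallows_prob q (avoiders pat231 n)) ->
     forall n : nat, (1 <= n)%N ->
       d n = (1 - q) * \sum_(1 <= k < n.+1)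
               q ^+ (k - 1) * (w_ q (k - 1) * w_ q (n - k) / w_ q n)
               * d (k - 1)%N * d (n - k)%N) /\
  (forall d : nat -> R,
     (forall n : nat, d n = mallows_prob q (avoiders pat213 n)) \/
     (forall n : nat, d n = mallows_prob q (avoiders pat132 n)) ->
     forall n : nat, (1 <= n)%N ->
       d n = (1 - q) * \sum_(1 <= k < n.+1)
               q ^+ ((n - k + 1) * (k - 1)) * (w_ q (k - 1) * w_ q (n - k) / w_ q n)
               * d (k - 1)%N * d (n - k)%N).
Proof.
split=> d dE n n0.
  have {dE} dE m : d m = mallows_prob q (avoiders pat312 m).
    by case: dE => -> //; rewrite !mallows_probE inv_gf231.
  rewrite dE (mallows_prob_rec hq0 hq1 (e := fun _ k => (k - 1)%N) _ n0).
    by congr (_ * _); apply: eq_bigr => k _; rewrite !dE.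
  by move=> m; rewrite inv_gf312S; apply: eq_bigr => k _; rewrite subn1.
(* Both patterns of the second part have the same generating function at [q], so only 132 is
   treated. *)
have {dE} dE m : d m = mallows_prob q (avoiders pat132 m).
  by case: dE => -> //; rewrite !mallows_probE inv_gf213 // gt_eqF.
rewrite dE (mallows_prob_rec hq0 hq1 (e := fun n k => ((n - k + 1) * (k - 1))%N) _ n0).
  by congr (_ * _); apply: eq_bigr => k _; rewrite !dE.
move=> m; rewrite inv_gf132S ?gt_eqF //; apply: eq_bigr => k _.
by rewrite subSS addn1 subn1.
Qed.
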